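(* Let $A\in\mathbb{Z}^{d\times n}$ be an integer matrix with columns $a_1,\dots,a_n$ such that there exists $c\in\mathbb{Q}^d$ with $c\cdot a_i>0$ for $i=1,\dots,n$. Let $Q$ be the semigroup generated by $a_1,\dots,a_n$ and $S$ its set of saturation points. Then the set $\min(S;Q)$ of $Q$-minimal saturation points is finite.
   Context: $\mathbb{N}=\{0,1,2,\dots\}$. $Q=\{\sum_{i=1}^n x_i a_i : x_i\in\mathbb{N}\}$, $K=\{\sum_{i=1}^n x_i a_i: x_i\in\mathbb{R}_{\ge 0}\}$, $L=\{\sum_{i=1}^n x_i a_i: x_i\in\mathbb{Z}\}$, and $Q_{\rm sat}=K\cap L$. $S=\{a\in Q: a+Q_{\rm sat}\subset Q\}$ is the set of saturation points. An element $a\in S$ is a $Q$-minimal saturation point if there is no $b\in S$, $b\neq a$, with $a-b\in Q$; equivalently $\{a-q: q\in Q\}\cap S=\{a\}$. $\min(S;Q)$ is the set of all $Q$-minimal saturation points. *)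

(* Defs.v *)
From mathcomp Require Import all_boot all_order all_algebra.
From mathcomp Require Import boolp classical_sets cardinality reals.

Set Implicit Arguments.
Unset Strict Implicit.
Unset Printing Implicit Defensive.

Import Order.TTheory GRing.Theory Num.Theory.

Local Open Scope classical_set_scope.
Local Open Scope ring_scope.

Definition semigroup_of (d n : nat) (A : 'M[int]_(d, n)) : set 'cV[int]_d :=
  [set v | exists x : 'I_n -> nat, v = \sum_(i < n) col i A *+ x i].

Definition lattice_of (d n : nat) (A : 'M[int]_(d, n)) : set 'cV[int]_d :=
  [set v | exists x : 'I_n -> int, v = \sum_(i < n) col i A *~ x i].

Definition cone_of (R : realType) (d n : nat) (A : 'M[int]_(d, n)) :
    set 'cV[R]_d :=
  [set v | exists x : 'I_n -> R, (forall i, 0 <= x i) /\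
     v = \sum_(i < n) x i *: map_mx intr (col i A)].
Arguments cone_of R {d n} A.

(* The intersection of the cone with the lattice. The lattice lies in Z^d and
   the cone in R^d, so Z^d is identified with its entrywise image in R^d. *)
Definition saturation (R : realType) (d n : nat) (A : 'M[int]_(d, n)) :
    set 'cV[int]_d :=
  [set v : 'cV[int]_d | cone_of R A (map_mx intr v) /\ lattice_of A v].
Arguments saturation R {d n} A.

Definition saturation_points (R : realType) (d n : nat) (A : 'M[int]_(d, n)) :
    set 'cV[int]_d :=
  [set a : 'cV[int]_d | semigroup_of A a /\
     [set a + q | q in saturation R A] `<=` semigroup_of A].
Arguments saturation_points R {d n} A.

Definition minimal_points (V : zmodType) (S Q : set V) : set V :=
  [set a : V | S a /\ ~ exists b, [/\ S b, b <> a & Q (a - b)]].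

(* Main.v *)
Require Import Defs.
From mathcomp Require Import all_boot all_order all_algebra.
From mathcomp Require Import boolp classical_sets cardinality reals.

(** Writing a semigroup element as [A x] with [x] in [N^n], pull [S] back to the
    set of exponents [x] with [A x] in [S].  By Dickson's lemma finitely many of
    these exponents lie below all the others.  If [A x] is [Q]-minimal and [y] is
    one of the finitely many exponents, [y <= x], then [A x - A y = A (x - y)] is
    in [Q], so [A x = A y]. *)

Set Implicit Arguments.
Unset Strict Implicit.
Unset Printing Implicit Defensive.

Import Order.TTheory GRing.Theory Num.Theory.

Local Open Scope classical_set_scope.
Local Open Scope ring_scope.

(** Induction on the list [r] of coordinates, for all [X] at once: the hypothesis serves both [X]
    itself and every level set of [f j] in [X]. Coordinates are functions on a fixed [T], so
    dropping one leaves the points unchanged. *)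
Lemma dickson_seq (T : choiceType) (I : eqType) (f : I -> T -> nat) (r : seq I)
    (X : set T) :
  exists F : set T, [/\ finite_set F, F `<=` X &
    forall x, X x -> exists2 y, F y & forall i, i \in r -> (f i y <= f i x)%N].
Proof.
elim: r X => [|j r IHr] X.
  have [->|/set0P [x0 Xx0]] := eqVneq X set0.
    by exists set0; split=> //; exact: finite_set0.
  exists [set x0]; split; [exact: finite_set1 | by move=> _ -> |].
  by move=> x _; exists x0.
have [F0 [finF0 F0X domF0]] := IHr X.
have [F domF] := choice (fun k => IHr (X `&` [set x | f j x = k])).
have [s F0s] := (finite_seqP F0).1 finF0.
(* Elements with [f j x >= K] are dominated by [F0] in coordinate [j] as well;
   only finitely many lower levels of [f j] remain. *)
pose K := (\max_(y <- s) f j y)%N.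
exists (F0 `|` \bigcup_(k in `I_K) F k); split.
- rewrite finite_setU; split=> //.
  by apply: bigcup_finite => [|k _]; [exact: finite_II | case: (domF k)].
- move=> y [/F0X // | [k _ Fky]].
  by have [_ /(_ y Fky) []] := domF k.
- move=> x Xx; have [ltxK|leKx] := ltnP (f j x) K.
    have [_ FX /(_ x (conj Xx erefl)) [y Fy leyx]] := domF (f j x).
    exists y; first by right; exists (f j x).
    (* [y] lies in the same level set of [f j] as [x], so coordinate [j] agrees. *)
    have [_ fjy] := FX y Fy.
    by move=> i; rewrite inE => /predU1P [->|/leyx //]; rewrite fjy.
  have [y F0y leyx] := domF0 x Xx.
  exists y; first by left.
  move=> i; rewrite inE => /predU1P [->|/leyx //].
  by apply: leq_trans leKx; apply: leq_bigmax_seq => //; move: F0y; rewrite F0s.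
Qed.

Lemma dickson (I : finType) (X : set (I -> nat)) :
  exists F : set (I -> nat), [/\ finite_set F, F `<=` X &
    forall x, X x -> exists2 y, F y & forall i, (y i <= x i)%N].
Proof.
have [F [finF FX domF]] := dickson_seq (fun i (x : I -> nat) => x i) (enum I) X.
exists F; split=> // x /domF [y Fy leyx]; exists y => // i.
by apply: leyx; rewrite mem_enum.
Qed.

Lemma finite_minimal_points (d n : nat) (A : 'M[int]_(d, n))
    (S : set 'cV[int]_d) :
  S `<=` semigroup_of A -> finite_set (minimal_points S (semigroup_of A)).
Proof.
move=> SQ; pose g (x : 'I_n -> nat) := \sum_(i < n) col i A *+ x i.
have [F [finF FS domF]] := dickson (g @^-1` S).
apply: (@sub_finite_set _ _ (g @` F)); last exact: finite_image.
move=> a [Sa mina]; have [x ax] := SQ a Sa.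
have [|y Fy leyx] := domF x; first by rewrite /preimage /= /g -ax.
exists y => //; apply: contrapT => gya; apply: mina.
exists (g y); split=> //; first exact: FS.
(* The truncated subtraction is exact, since [y i <= x i] for all [i]. *)
exists (fun i => x i - y i)%N; rewrite ax /g -sumrB.
by apply: eq_bigr => i _; rewrite mulrnBr.
Qed.

Theorem proposition4p4 (R : realType) (d n : nat) (A : 'M[int]_(d, n))
    (hA : exists c : 'cV[rat]_d,
       forall i : 'I_n, 0 < \sum_(j < d) c j 0 * (A j i)%:~R) :
  finite_set (minimal_points (saturation_points R A) (semigroup_of A)).
Proof. by apply: finite_minimal_points => a []. Qed.
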